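(* Let $d=2$ and let $Z_{\tau\in[0,T]}$ be the Markovian Bernstein process in $\mathbb R^2$ (in the sense recalled in the context) associated with the system $$\partial_t u=\tfrac12\Delta_{\mathsf x}u-\tfrac{|\mathsf x|^2}{2}u\ \text{ on }\mathbb R^2\times(0,T],\quad u(\cdot,0)=\mathcal N\varphi_0,$$ $$-\partial_t v=\tfrac12\Delta_{\mathsf x}v-\tfrac{|\mathsf x|^2}{2}v\ \text{ on }\mathbb R^2\times[0,T),\quad v(\cdot,T)=\mathcal N\psi_T,$$ with $\varphi_0=\delta_0$ the Dirac measure at the origin and $\psi_T(\mathsf x)=\exp[-|\mathsf x|^2/2]$. Let $\rho(t)=\sinh(t)\exp[-t]$ and $A_{R_1,R_2}=\{\mathsf x\in\mathbb R^2: R_1\le|\mathsf x|<R_2\}$. Then the following statements hold: (a) If $0=R_1<R_2$ one has $\mathbb P_\mu(Z_0\in A_{0,R_2})=1$, and the function $t\mapsto\mathbb P_\mu(Z_t\in A_{0,R_2})$ is monotone decreasing on $[0,T]$, eventually reaching the minimal value $$\mathbb P_\mu(Z_T\in A_{0,R_2})=1-\exp\left[-\frac{R_2^2}{2\rho(T)}\right].$$ (b) If $0<R_1<R_2<1$ one has $\mathbb P_\mu(Z_0\in A_{R_1,R_2})=0$ and $\mathbb P_\mu(Z_t\in A_{R_1,R_2})>0$ as soon as $t>0$. Moreover, if $T$ is sufficiently large there exists $t^*\in(0,T)$ such that the function $t\mapsto\mathbb P_\mu(Z_t\in A_{R_1,R_2})$ is monotone decreasing on $[t^*,T]$. (c)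 If $1\le R_1<R_2$ one still has $\mathbb P_\mu(Z_0\in A_{R_1,R_2})=0$, but the function $t\mapsto\mathbb P_\mu(Z_t\in A_{R_1,R_2})$ is monotone increasing throughout $[0,T]$.
   Context: $T>0$ is arbitrary. The Green's function of the system (in dimension $d$, here $d=2$) is Mehler's kernel $$g(\mathsf x,t,\mathsf y)=(2\pi\sinh t)^{-d/2}\exp\left[-\frac{\cosh(t)(|\mathsf x|^2+|\mathsf y|^2)-2(\mathsf x,\mathsf y)_{\mathbb R^d}}{2\sinh t}\right],\quad t>0.$$ The constant $\mathcal N>0$ is fixed by the normalization $\mathcal N^2\int_{\mathbb R^d\times\mathbb R^d}\varphi_0(d\mathsf x)\,g(\mathsf x,T,\mathsf y)\psi_T(\mathsf y)\,d\mathsf y=1$, and $\mu$ is the probability measure on $\mathbb R^d\times\mathbb R^d$ given by $\mu(d\mathsf x,d\mathsf y)=\mathcal N^2\varphi_0(d\mathsf x)g(\mathsf x,T,\mathsf y)\psi_T(\mathsf y)\,d\mathsf y$. The solutions are $u(\mathsf x,t)=\mathcal N\int g(\mathsf x,t,\mathsf y)\varphi_0(d\mathsf y)=\mathcal N g(\mathsf x,t,\mathsf o)$ for $t\in(0,T]$, where $\mathsf o$ is the origin, and $v(\mathsf x,t)=\mathcal N\int g(\mathsf x,T-t,\mathsf y)\psi_T(\mathsf y)\,d\mathsf y$ for $t\in[0,T)$, $v(\cdot,T)=\mathcal N\psi_T$. An $\mathbb R^d$-valued process $Z_{\tau\in[0,T]}$ is a Bernstein process if $\mathbb E(f(Z_r)\mid\mathcal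 F_s^+\vee\mathcal F_t^-)=\mathbb E(f(Z_r)\mid Z_s,Z_t)$ for every bounded Borel $f:\mathbb R^d\to\mathbb R$ and all $r\in(s,t)\subset[0,T]$, where $\mathcal F_s^+=\sigma(Z_\tau:\tau\le s)$ and $\mathcal F_t^-=\sigma(Z_\tau:\tau\ge t)$. The Bernstein process associated with the system is the Markovian Bernstein process on a probability space $(\Omega,\mathcal F,\mathbb P_\mu)$ such that: (i) $(Z_0,Z_T)$ has law $\mu$; (ii) for $n\ge2$, $0<t_1<\dots<t_n<T$ and Borel sets $F_1,\dots,F_n$, $$\mathbb P_\mu(Z_{t_1}\in F_1,\dots,Z_{t_n}\in F_n)=\int_{F_1}d\mathsf x_1\cdots\int_{F_n}d\mathsf x_n\prod_{k=2}^n g(\mathsf x_k,t_k-t_{k-1},\mathsf x_{k-1})\,u(\mathsf x_1,t_1)v(\mathsf x_n,t_n);$$ (iii) for every Borel set $F$, $\mathbb P_\mu(Z_t\in F)=\int_F u(\mathsf x,t)v(\mathsf x,t)\,d\mathsf x$ for $t\in(0,T]$, and $\mathbb P_\mu(Z_0\in F)=\mathcal N\int_F v(\mathsf x,0)\,\delta_0(d\mathsf x)$. *)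

(* Defs.v *)
From HB Require Import structures.
From mathcomp Require Import all_boot all_order all_algebra.
From mathcomp Require Import all_classical all_reals all_analysis.

Set Implicit Arguments.
Unset Strict Implicit.
Unset Printing Implicit Defensive.

Import Order.TTheory GRing.Theory Num.Theory.
Import numFieldNormedType.Exports.

Local Open Scope classical_set_scope.
Local Open Scope ring_scope.

(* R^2 with the product (= Borel) sigma-algebra.  The library norm on a
   product is the sup norm, hence the explicit Euclidean norm below. *)

Notation plane R := (measurableTypeR R * measurableTypeR R)%type.

Section Plane.
Variable R : realType.
Notation plane := (plane R).

Definition origin : plane := (0 : R, 0 : R).

Definition inner (x y : plane) : R := (x.1 : R) * y.1 + (x.2 : R) * y.2.

Definition enorm (x : plane) : R := Num.sqrt (inner x x).

Definition annulus (R1 R2 : R) : set plane :=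
  [set x | R1 <= enorm x < R2].

End Plane.

Notation lebesgue2 R := (@lebesgue_measure R \x @lebesgue_measure R)%E.

(* The system consists of the forward problem
     d_t u = Delta u / 2 - |x|^2 u / 2 on (0, T],    u(., 0) = N delta_0,
   and of the backward problem
     - d_t v = Delta v / 2 - |x|^2 v / 2 on [0, T),  v(., T) = N psi_T.
   Its Green's function is Mehler's kernel, and [forward_sol] and
   [backward_sol] are the solutions u and v it generates. *)

Section System.
Variable R : realType.
Notation plane := (plane R).
Notation lebesgue2 := (lebesgue2 R).

Definition sinh (t : R) : R := (expR t - expR (- t)) / 2.

Definition cosh (t : R) : R := (expR t + expR (- t)) / 2.

(* The prefactor is (2 pi sinh t)^(-d/2) with d = 2.  Only used for t > 0. *)
Definition mehler (x : plane) (t : R) (y : plane) : R :=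
  (2 * pi * sinh t)^-1 *
  expR (- ((cosh t * (enorm x ^+ 2 + enorm y ^+ 2) - 2 * inner x y)
           / (2 * sinh t))).

Definition phi0 : {finite_measure set plane -> \bar R} :=
  dirac (origin R).

Definition psiT (x : plane) : R := expR (- (enorm x ^+ 2 / 2)).

(* Meant for t in (0, T]. *)
Definition forward_sol (N : R) (x : plane) (t : R) : R :=
  N * \int[phi0]_y mehler x t y.

(* Meant for t in [0, T]. *)
Definition backward_sol (T N : R) (x : plane) (t : R) : R :=
  if t < T then N * \int[lebesgue2]_y (mehler x (T - t) y * psiT y)
  else N * psiT x.

(* N^2 phi0(dx) g(x, T, y) psi_T(y) dy. *)
Definition endpoint_law (T N : R) (C : set (plane * plane)) : \bar R :=
  ((N ^+ 2)%:E *
   \int[phi0 \x lebesgue2]_(p in C) (mehler p.1 T p.2 * psiT p.2)%:E)%E.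

Definition rho (t : R) : R := sinh t * expR (- t).

End System.

Section Processes.
Context (R : realType) (d : measure_display) (Omega : measurableType d).
Variables (P : probability Omega R) (T : R) (Z : R -> Omega -> plane R).

(* [Y] is a version of the conditional expectation of [X] given the
   sub-sigma-algebra [G]. *)
Definition cond_exp (G : set_system Omega) (X Y : Omega -> R) : Prop :=
  [/\ preimage_set_system setT Y measurable `<=` G,
      P.-integrable setT (EFin \o Y) &
      forall A, G A ->
        (\int[P]_(w in A) (Y w)%:E = \int[P]_(w in A) (X w)%:E)%E].

(* E(X | G) = E(X | H) almost surely. *)
Definition cond_exp_eq (G H : set_system Omega) (X : Omega -> R) : Prop :=
  forall Y Y' : Omega -> R, cond_exp G X Y -> cond_exp H X Y' ->
    {ae P, forall w, Y w = Y' w}.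

(* sigma(Z_tau : tau in I). *)
Definition sigma_of (I : set R) : set_system Omega :=
  <<s \bigcup_(tau in I) preimage_set_system setT (Z tau) measurable >>.

Definition past (s : R) : set_system Omega := sigma_of `[0, s].

Definition future (t : R) : set_system Omega := sigma_of `[t, T].

Definition bounded_borel (f : plane R -> R) : Prop :=
  measurable_fun setT f /\ exists M : R, forall x, `|f x| <= M.

Definition is_bernstein : Prop :=
  forall (f : plane R -> R) (s r t : R), bounded_borel f ->
    0 <= s -> s < r -> r < t -> t <= T ->
    cond_exp_eq <<s past s `|` future t >> (sigma_of [set s; t]) (f \o Z r).

Definition is_markov : Prop :=
  forall (f : plane R -> R) (s t : R), bounded_borel f ->
    0 <= s -> s < t -> t <= T ->
    cond_exp_eq (past s) (sigma_of [set s]) (f \o Z t).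

End Processes.

Section BernsteinProcess.
Variable R : realType.

(* int_{F_1} dx_1 ... int_{F_n} dx_n f(x_1, ..., x_n) for
   Fs = [:: F_1; ...; F_n]. *)
Fixpoint iterated_integral (Fs : seq (set (plane R)))
    (f : seq (plane R) -> R) : \bar R :=
  if Fs is F :: Fs' then
    (\int[lebesgue2 R]_(x in F)
       iterated_integral Fs' (fun xs => f (x :: xs)))%E
  else (f [::])%:E.

(* prod_{k=2}^n g(x_k, t_k - t_{k-1}, x_{k-1}) u(x_1, t_1) v(x_n, t_n),
   where x_k and t_k are the items of index k - 1 in [xs] and [ts]. *)
Definition joint_density (T N : R) (ts : seq R) (xs : seq (plane R)) : R :=
  let n := size ts in
  let x k := nth (origin R) xs k in
  (\prod_(1 <= k < n) mehler (x k) (ts`_k - ts`_k.-1) (x k.-1)) *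
  forward_sol N (x 0%N) ts`_0 * backward_sol T N (x n.-1) ts`_n.-1.

(* The Markovian Bernstein process associated with the system, for the
   horizon [T] and the normalization constant [N].  Only the restriction of
   [Z] to [0, T] is constrained. *)
Record bernstein_process (T N : R) (d : measure_display)
    (Omega : measurableType d) (P : probability Omega R)
    (Z : R -> Omega -> plane R) : Prop := BernsteinProcess {
  horizon_gt0 : 0 < T ;
  normalization_gt0 : 0 < N ;
  normalizationE : endpoint_law T N setT = 1%E ;
  process_measurable :
    forall t, 0 <= t <= T -> measurable_fun setT (Z t) ;
  process_markov : is_markov P T Z ;
  process_bernstein : is_bernstein P T Z ;
  endpointsE : forall C : set (plane R * plane R), measurable C ->
    P ((fun w => (Z 0 w, Z T w)) @^-1` C) = endpoint_law T N C ;
  fddE : forall (ts : seq R) (Fs : seq (set (plane R))),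
    (2 <= size ts)%N -> size Fs = size ts ->
    path <%R 0 (rcons ts T) ->
    (forall k, (k < size Fs)%N -> measurable (nth set0 Fs k)) ->
    P (\bigcap_(k < size ts) (Z ts`_k @^-1` nth set0 Fs k)) =
    iterated_integral Fs (joint_density T N ts) ;
  marginalE : forall (t : R) (F : set (plane R)),
    0 < t <= T -> measurable F ->
    P (Z t @^-1` F) =
    (\int[lebesgue2 R]_(x in F)
       (forward_sol N x t * backward_sol T N x t)%:E)%E ;
  marginal0E : forall F : set (plane R), measurable F ->
    P (Z 0 @^-1` F) =
    (N%:E * \int[@phi0 R]_(x in F) (backward_sol T N x 0)%:E)%E
}.

End BernsteinProcess.

(* Main.v *)
(* The Gaussian psi_T is an eigenfunction of the Mehler semigroup, with
   eigenvalue exp(-s) in dimension 2, so that v(x, t) is a multiple of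
   exp(-|x|^2 / 2) and u v is the centred Gaussian density of variance rho t.
   The push-forward of the planar Lebesgue measure under |x|^2 is pi times the
   Lebesgue measure on [0, +oo[, because disks have area pi r^2; hence
     P(Z_t in A_{R1,R2}) = exp(-a / rho t) - exp(-b / rho t),
   with a = R1^2 / 2 and b = R2^2 / 2.  As a function of x = 1 / rho t, which
   decreases to a limit > 2, this difference is increasing for x <= 1 / b and
   decreasing for x >= 1 / a. *)
Require Import Defs.
From HB Require Import structures.
From mathcomp Require Import all_boot all_order all_algebra.
From mathcomp Require Import ring lra.
From mathcomp Require Import all_classical all_reals all_analysis.
From mathcomp Require Import measurable_realfun.

Set Implicit Arguments.
Unset Strict Implicit.
Unset Printing Implicit Defensive.

Import Order.TTheory GRing.Theory Num.Theory.
Import numFieldNormedType.Exports.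

Local Open Scope classical_set_scope.
Local Open Scope ring_scope.

(** * Area of a planar disk *)

Section DiskArea.
Variable R : realType.
Implicit Types r c x y : R.

Lemma is_derive_scaled_sin r x :
  is_derive x 1 (fun x : R => r * sin x) (r * cos x).
Proof. by apply: is_deriveZ. Qed.

Lemma derive1_scaled_sin r :
  derive1 (fun x : R => r * sin x) = (fun x : R => r * cos x).
Proof.
apply/funext => x; rewrite derive1E.
by have /@derive_val -> := is_derive_scaled_sin r x.
Qed.

Lemma continuous_scaled_sin r : continuous (fun x : R => r * sin x).
Proof. by move=> x; apply: cvgM; [exact: cvg_cst|exact: continuous_sin]. Qed.

Lemma continuous_scaled_cos r : continuous (fun x : R => r * cos x).
Proof. by move=> x; apply: cvgM; [exact: cvg_cst|exact: continuous_cos]. Qed.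

Lemma continuous_2cos2 : continuous (fun x : R => 2 * cos x ^+ 2).
Proof.
move=> x; apply: cvgM; first exact: cvg_cst.
by apply: (@continuous_comp _ _ _ cos (fun y : R => y ^+ 2));
  [exact: continuous_cos|exact: exprn_continuous].
Qed.

(** An antiderivative is [x + sin x * cos x], whose derivative 1 + cos^2 - sin^2 equals 2 cos^2. *)
Lemma integral_2cos2 :
  (\int[@lebesgue_measure R]_(x in `[(- (pi / 2))%R, (pi / 2)%R])
     (2 * cos x ^+ 2)%:E)%E = pi%:E.
Proof.
have pi0 := @pi_gt0 R.
have dF x : is_derive x 1 (fun x : R => x + sin x * cos x) (2 * cos x ^+ 2).
  apply: is_derive_eq; rewrite -[in RHS](mulr_natl _ 2)/GRing.scale/=.
  by move: (cos2Dsin2 x) => h; nra.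
rewrite (@continuous_FTC2 _ _ (fun x : R => x + sin x * cos x)).
- rewrite -EFinB; congr EFin.
  by rewrite sinN cosN cos_pihalf !mulr0 !addr0 opprK -splitr.
- lra.
- by apply: continuous_subspaceT; exact: continuous_2cos2.
- have cF : continuous (fun x : R => x + sin x * cos x).
    by move=> x; apply: cvgD => //; apply: cvgM;
      [exact: continuous_sin|exact: continuous_cos].
  split.
  + by move=> x _; have [] := dF x.
  + by apply: cvg_at_right_filter; exact: cF.
  + by apply: cvg_at_left_filter; exact: cF.
- by move=> x _; rewrite derive1E; have /@derive_val -> := dF x.
Qed.

Lemma continuous_chord c :
  continuous (fun x : R => 2 * Num.sqrt (c - x ^+ 2)).
Proof.
move=> x; apply: cvgM; first exact: cvg_cst.
apply: (@continuous_comp _ _ _ (fun x : R => c - x ^+ 2) Num.sqrt).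
  by apply: cvgB; [exact: cvg_cst|exact: exprn_continuous].
exact: sqrt_continuous.
Qed.

(** Substitute x = r sin u with u in [-pi/2, pi/2]: there cos u is nonnegative, so the root becomes
    r cos u and the integrand r^2 times 2 cos^2 u. *)
Lemma integral_chord r : 0 < r ->
  (\int[@lebesgue_measure R]_(x in `[(- r)%R, r])
     (2 * Num.sqrt (r ^+ 2 - x ^+ 2))%:E = (pi * r ^+ 2)%:E)%E.
Proof.
move=> r0; have pi0 := @pi_gt0 R.
pose F x : R := r * sin x.
have Fl : F (- (pi / 2)) = - r by rewrite /F sinN sin_pihalf mulrN1.
have Fr : F (pi / 2) = r by rewrite /F sin_pihalf mulr1.
have := @integration_by_substitution_increasing R F
  (fun x : R => 2 * Num.sqrt (r ^+ 2 - x ^+ 2)) (- (pi / 2)) (pi / 2).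
rewrite Fl Fr derive1_scaled_sin => ->.
- transitivity (\int[@lebesgue_measure R]_(x in `[(- (pi / 2))%R, (pi / 2)%R])
     ((r ^+ 2)%:E * (2 * cos x ^+ 2)%:E))%E.
    apply: eq_integral => x; rewrite inE/= in_itv/= => xpi.
    rewrite -EFinM; congr EFin; rewrite !fctE /F.
    have -> : r ^+ 2 - (r * sin x) ^+ 2 = (r * cos x) ^+ 2.
      by rewrite !exprMn sin2cos2; ring.
    rewrite sqrtr_sqr ger0_norm; first by ring.
    by rewrite mulr_ge0 ?(ltW r0)// cos_ge0_pihalf.
  rewrite integralZl//; first by rewrite integral_2cos2 -EFinM mulrC.
  apply: continuous_compact_integrable; first exact: segment_compact.
  by apply: continuous_subspaceT; exact: continuous_2cos2.
- lra.
- by move=> x y xI yI xy; rewrite /F ltr_pM2l// ltr_sin.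
- by move=> x _; exact: continuous_scaled_cos.
- apply/cvg_ex; exists (r * cos (- (pi / 2))).
  by apply: cvg_at_right_filter; exact: continuous_scaled_cos.
- apply/cvg_ex; exists (r * cos (pi / 2)).
  by apply: cvg_at_left_filter; exact: continuous_scaled_cos.
- split.
  + by move=> x _; have [] := is_derive_scaled_sin r x.
  + by apply: cvg_at_right_filter; exact: continuous_scaled_sin.
  + by apply: cvg_at_left_filter; exact: continuous_scaled_sin.
- by apply: continuous_subspaceT; exact: continuous_chord.
Qed.

Lemma measurable_sqnorm :
  measurable_fun [set: plane R] (fun p => inner p p).
Proof.
apply: measurable_funD; apply: measurable_funM;
  by [exact: measurable_fst|exact: measurable_snd].
Qed.

Lemma measurable_sqnorm_preimage (B : set R) : measurable B ->
  measurable ((fun x : plane R => inner x x) @^-1` B).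
Proof.
by move=> mB; rewrite -[X in measurable X]setTI; exact: measurable_sqnorm.
Qed.

(** The hypothesis excludes empty sections: for x^2 > c the root is 0 by convention and the interval
    would still contain 0. *)
Lemma xsection_disk c x : x ^+ 2 <= c ->
  xsection [set z : plane R | inner z z <= c] x =
  `[- Num.sqrt (c - x ^+ 2), Num.sqrt (c - x ^+ 2)]%classic.
Proof.
move=> xc; rewrite xsectionE; apply/seteqP; split => y /=;
  rewrite in_itv/= /inner/= -!expr2 -ler_norml.
- move=> h; rewrite -[`|y|]sqrtr_sqr ler_wsqrtr//.
  by rewrite lerBrDl.
- rewrite -(ler_pXn2r (n := 2)) ?nnegrE// sqr_sqrtr ?subr_ge0//.
  by rewrite real_normK ?num_real// lerBrDl.
Qed.

(** The product measure integrates the lengths of vertical sections, which are the chords of the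
    disk. *)
Lemma disk_area r : 0 <= r ->
  lebesgue2 R [set p : plane R | inner p p <= r ^+ 2] = (pi * r ^+ 2)%:E.
Proof.
move=> r0; rewrite /product_measure1/=.
transitivity (\int[@lebesgue_measure R]_(x in `[(- r)%R, r])
  (2 * Num.sqrt (r ^+ 2 - x ^+ 2))%:E)%E; last first.
  (* The substitution behind [integral_chord] is strictly increasing only for r > 0, so the
     degenerate disk is treated apart. *)
  have [->|rn0] := eqVneq r 0.
    by rewrite oppr0 set_itv1 integral_set1 expr0n/= mulr0.
  by rewrite integral_chord// lt_def rn0.
rewrite [RHS]integral_mkcond; apply: eq_integral => x _.
have xr : (x \in `[(- r)%R, r]%classic) = (x ^+ 2 <= r ^+ 2).
  rewrite mem_setE in_itv/= -ler_norml -(ler_pXn2r (n := 2)) ?nnegrE//.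
  by rewrite real_normK ?num_real.
rewrite patchE xr; case: ifPn => [xr2|]; last first.
  rewrite -ltNge => xr2; rewrite /= (_ : xsection _ x = set0) ?measure0//.
  rewrite xsectionE; apply/seteqP; split => y //=; rewrite /inner/= -!expr2.
  by have := sqr_ge0 y; lra.
rewrite /= xsection_disk// lebesgue_measure_itv/= lte_fin.
have := sqrtr_ge0 (r ^+ 2 - x ^+ 2).
set s := Num.sqrt _; rewrite le_eqVlt => /predU1P[<-|s0].
  by rewrite oppr0 ltxx mulr0.
by rewrite ifT; [rewrite -EFinB; congr EFin; ring|lra].
Qed.

End DiskArea.

(** * Push-forward under the squared norm and Gaussian integrals over annuli *)

Section RadialIntegral.
Variable R : realType.
Implicit Types (k r c x y : R) (A : set R).

Let sqnorm (p : plane R) : measurableTypeR R := inner p p.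

Let measurable_sqnormT : measurable_fun setT sqnorm.
Proof. exact: measurable_sqnorm. Qed.

Lemma inner_ge0 (p : plane R) : 0 <= inner p p.
Proof. by rewrite /inner -!expr2 addr_ge0 ?sqr_ge0. Qed.

Lemma enorm_ge0 (p : plane R) : 0 <= enorm p.
Proof. exact: sqrtr_ge0. Qed.

Lemma enorm_sqr (p : plane R) : enorm p ^+ 2 = inner p p.
Proof. by rewrite sqr_sqrtr// inner_ge0. Qed.

Lemma enorm_origin : enorm (origin R) = 0.
Proof. by rewrite /enorm /inner /origin/= !mulr0 addr0 sqrtr0. Qed.

Lemma sqnorm_area_itvNy c :
  lebesgue2 R (sqnorm @^-1` `]-oo, c]) = (pi * Num.max c 0)%:E.
Proof.
have -> : sqnorm @^-1` `]-oo, c] = [set p : plane R | inner p p <= c].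
  by apply/seteqP; split => p /=; rewrite in_itv.
have [c0|c0] := leP 0 c.
  by have := disk_area (sqrtr_ge0 c); rewrite sqr_sqrtr.
rewrite mulr0 (_ : [set _ | _] = set0) ?measure0//.
apply/seteqP; split => p //= pc; have := inner_ge0 p; lra.
Qed.

(** The half-open intervals are those on which Lebesgue measure is characterized; the maxima with 0
    discard the negative values, which a squared norm never takes. *)
Lemma sqnorm_area_itv x y : x <= y ->
  lebesgue2 R (sqnorm @^-1` `]x, y]) = (pi * (Num.max y 0 - Num.max x 0))%:E.
Proof.
move=> xy.
have msq c : measurable (sqnorm @^-1` `]-oo, c]).
  exact: measurable_sqnorm_preimage.
have -> : sqnorm @^-1` `]x, y] =
    sqnorm @^-1` `]-oo, y] `\` sqnorm @^-1` `]-oo, x].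
  apply/seteqP; split => p /=; rewrite !in_itv/=.
    by move=> /andP[xp py]; split => //; apply/negP; rewrite -ltNge.
  by move=> [py /negP]; rewrite -ltNge => ->.
have fin : (lebesgue2 R (sqnorm @^-1` `]-oo, y]) < +oo)%E.
  by rewrite sqnorm_area_itvNy ltry.
transitivity (lebesgue2 R (sqnorm @^-1` `]-oo, y]) -
              lebesgue2 R (sqnorm @^-1` `]-oo, x]))%E.
  have <- : sqnorm @^-1` `]-oo, y] `&` sqnorm @^-1` `]-oo, x] =
      sqnorm @^-1` `]-oo, x].
    by apply/setIidr => p /=; rewrite !in_itv/= => /le_trans; exact.
  by rewrite [in LHS]setDE setCI setIUr -!setDE setDv set0U; exact: measureD.
by rewrite !sqnorm_area_itvNy -EFinB mulrBr.
Qed.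

Let pinv : {nonneg R} := NngNum (ltW (etrans (invr_gt0 pi) (pi_gt0 R))).
Let pinn : {nonneg R} := NngNum (pi_ge0 R).

Let neg_measurable : measurable (`]-oo, 0%R[ : set (measurableTypeR R)).
Proof. exact: measurable_itv. Qed.

(** Closed with [Defined] so that its values still unfold to areas of preimages. *)
Let sqnorm_area : {measure set (measurableTypeR R) -> \bar R}.
Proof.
refine (pushforward (lebesgue2 R) sqnorm : {measure set _ -> \bar R}).
exact: measurable_sqnormT.
Defined.

Lemma pushforward_sqnorm A : measurable A -> A `<=` `[0, +oo[ ->
  sqnorm_area A = (pi%:E * @lebesgue_measure R A)%E.
Proof.
move=> mA A0.
(* Adding the Lebesgue measure of the negative half-line makes the uniqueness
   of the Lebesgue measure on the whole of R applicable. *)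
pose nu := measure_add (mscale pinv sqnorm_area)
  (mrestr (@lebesgue_measure R) neg_measurable).
have nuE B : nu B = ((pi^-1)%:E * lebesgue2 R (sqnorm @^-1` B) +
    @lebesgue_measure R (B `&` `]-oo, 0%R[))%E by exact: measure_addE.
have -> : lebesgue_measure A = nu A.
  apply: lebesgue_measure_unique => // _ /ocitvP[->|[[x y]/= xy ->]].
    by rewrite !measure0.
  rewrite [RHS]nuE (sqnorm_area_itv (ltW xy)) -EFinM mulKf ?gt_eqF ?pi_gt0//.
  (* The restricted Lebesgue measure accounts for the negative part of the interval and the scaled
     push-forward for the rest; the two lengths add up to y - x. *)
  have -> : `]x, y] `&` `]-oo, 0[ = (if y < 0 then `]x, y] else `]x, 0[)%classic.
    case: ltP => y0; apply/seteqP; split => z /=; rewrite !in_itv/=.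
    - by case.
    - by move=> /andP[-> zy]; rewrite zy; split => //; lra.
    - by move=> [/andP[-> _] ->].
    - by move=> /andP[-> z0]; rewrite z0/=; split => //; lra.
  rewrite fun_if !lebesgue_measure_itv/= !lte_fin xy.
  case: ltP => y0; case: ltP => x0; rewrite -!EFinB ?adde0 -?EFinD;
  by congr EFin; lra.
(* Since A avoids the negative half-line, the auxiliary summand vanishes on it. *)
rewrite nuE (_ : A `&` _ = set0).
  by rewrite measure0 adde0 muleA -EFinM divff ?mul1e// gt_eqF ?pi_gt0.
apply/seteqP; split => z /=; last by [].
move=> [/A0/=]; rewrite !in_itv/= andbT; lra.
Qed.

Lemma annulus_itv r1 r2 : 0 <= r1 -> 0 <= r2 ->
  annulus r1 r2 = sqnorm @^-1` `[r1 ^+ 2, r2 ^+ 2[.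
Proof.
move=> r10 r20; rewrite /annulus /sqnorm.
apply/seteqP; split => p /=; rewrite in_itv/= -enorm_sqr;
by rewrite ler_sqr ?ltr_sqr ?nnegrE ?enorm_ge0.
Qed.

Lemma measurable_annulus r1 r2 : 0 <= r1 -> 0 <= r2 ->
  measurable (annulus r1 r2 : set (plane R)).
Proof.
by move=> r10 r20; rewrite annulus_itv//; exact: measurable_sqnorm_preimage.
Qed.

(** Change of variables to the squared norm. The annulus gives a half-open interval; its missing
    endpoint is null, and the closed form suits the fundamental theorem of calculus. *)
Lemma integral_annulus (f : R -> R) r1 r2 : 0 <= r1 -> r1 <= r2 ->
  continuous f -> (forall x, 0 <= f x) ->
  (\int[lebesgue2 R]_(p in annulus r1 r2) (f (enorm p ^+ 2))%:E =
   pi%:E * \int[@lebesgue_measure R]_(x in `[(r1 ^+ 2)%R, (r2 ^+ 2)%R])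
             (f x)%:E)%E.
Proof.
move=> r10 r12 cf f0.
have mf : measurable_fun setT (EFin \o f).
  by apply/measurable_EFinP; exact: continuous_measurable_fun.
rewrite annulus_itv ?(le_trans r10)//.
under eq_integral do rewrite enorm_sqr.
transitivity (\int[sqnorm_area]_(x in `[(r1 ^+ 2)%R, (r2 ^+ 2)%R[) (f x)%:E)%E.
  apply/esym/(ge0_integral_pushforward measurable_sqnormT) => //.
    exact: measurable_funTS.
  by move=> x _; rewrite lee_fin.
rewrite (eq_measure_integral (mscale pinn (@lebesgue_measure R))); last first.
  move=> B mB BI; apply: pushforward_sqnorm => // x /BI/=.
  by rewrite !in_itv/= andbT => /andP[+ _]; exact/le_trans/sqr_ge0.
rewrite ge0_integral_mscale//=; last 2 first.
- exact: measurable_funTS.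
- by move=> x _; rewrite lee_fin.
by rewrite integral_itv_bndo_bndc//; exact: measurable_funTS.
Qed.

Lemma continuous_expRN k : continuous (fun t : R => expR (- (k * t))).
Proof.
move=> t; apply: (@continuous_comp _ _ _ (fun t : R => - (k * t)) expR).
  by apply: cvgN; exact: mulrl_continuous.
exact: continuous_expR.
Qed.

Lemma integral_expRN k x y : 0 < k -> x <= y ->
  (\int[@lebesgue_measure R]_(t in `[x, y]) (k * expR (- (k * t)))%:E =
   (expR (- (k * x)) - expR (- (k * y)))%:E)%E.
Proof.
move=> k0; rewrite le_eqVlt => /predU1P[->|xy].
  by rewrite set_itv1 integral_set1 subrr.
pose F t : R := - expR (- (k * t)).
have dF (t : R) : is_derive t 1 F (k * expR (- (k * t))).
  by rewrite /F; apply: is_derive_eq; rewrite /GRing.scale/=; ring.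
have cexp := @continuous_expRN k.
have cF : continuous F by move=> t; apply: cvgN; exact: cexp.
rewrite (@continuous_FTC2 _ _ F)//.
- by rewrite -EFinB /F; congr EFin; ring.
- apply: continuous_subspaceT => t; apply: cvgM; first exact: cvg_cst.
  exact: cexp.
- split.
  + by move=> t _; have [] := dF t.
  + by apply: cvg_at_right_filter; exact: cF.
  + by apply: cvg_at_left_filter; exact: cF.
- by move=> t _; rewrite derive1E; have /@derive_val -> := dF t.
Qed.

(** In the variable |p|^2 the density is 1/pi times an exponential density of rate 1/(2r), and the
    factor pi of the push-forward cancels 1/pi. *)
Lemma gaussian_annulus r r1 r2 : 0 < r -> 0 <= r1 -> r1 <= r2 ->
  (\int[lebesgue2 R]_(p in annulus r1 r2)
     ((2 * pi * r)^-1 * expR (- (enorm p ^+ 2 / (2 * r))))%:E =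
   (expR (- (r1 ^+ 2 / (2 * r))) - expR (- (r2 ^+ 2 / (2 * r))))%:E)%E.
Proof.
move=> r0 r10 r12; have pi0 := @pi_gt0 R.
pose k := (2 * r)^-1; have k0 : 0 < k by rewrite invr_gt0; lra.
pose f x : R := (pi^-1 * (k * expR (- (k * x)))).
rewrite -[LHS](_ : \int[lebesgue2 R]_(p in annulus r1 r2)
    (f (enorm p ^+ 2))%:E = _)%E; last first.
  by apply: eq_integral => p _; congr EFin; rewrite /f /k invfM
    (mulrC (enorm p ^+ 2)) invfM mulrA; congr (_ * _); field; lra.
have ck : continuous (fun x : R => k * expR (- (k * x))).
  by move=> x; apply: cvgM; [exact: cvg_cst|exact: continuous_expRN].
rewrite integral_annulus//; last 2 first.
- by move=> x; apply: cvgM; [exact: cvg_cst|exact: ck].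
- by move=> x; rewrite /f !mulr_ge0 ?expR_ge0 ?invr_ge0 ?ltW//; lra.
under eq_integral do rewrite /f EFinM.
rewrite ge0_integralZl//; last 3 first.
- apply: measurable_funTS; apply/measurable_EFinP.
  exact: continuous_measurable_fun.
- by move=> x _; rewrite lee_fin mulr_ge0 ?expR_ge0 ?ltW.
- by rewrite lee_fin invr_ge0 ltW.
rewrite integral_expRN ?lerXn2r ?nnegrE ?(le_trans r10)//.
by rewrite muleA -EFinM divff ?lt0r_neq0// mul1r !(mulrC k).
Qed.

End RadialIntegral.

(** * Mehler's kernel, the explicit solutions and their product *)

Section Kernel.
Variable R : realType.
Implicit Types (s t T N : R) (x y : plane R).

(** This form shows that [rho] increases strictly from 0 at time 0 and stays below 1/2. *)
Lemma rhoE t : rho t = (1 - expR (- (2 * t))) / 2.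
Proof.
rewrite /rho /sinh -mulrA (mulrC 2^-1) mulrA mulrBl -!expRD subrr expR0.
by congr ((1 - expR _) / 2); ring.
Qed.

Lemma rho_lt_half t : rho t < 2^-1.
Proof. by rewrite rhoE; have := expR_gt0 (- (2 * t)); lra. Qed.

Lemma ltr_rho s t : (rho s < rho t) = (s < t).
Proof.
rewrite !rhoE ltr_pM2r ?invr_gt0// ltrD2l ltrN2 ltr_expR ltrN2.
by rewrite ltr_pM2l.
Qed.

Lemma rho0 : rho 0 = 0 :> R.
Proof. by rewrite rhoE mulr0 oppr0 expR0 subrr mul0r. Qed.

Lemma rho_gt0 t : 0 < t -> 0 < rho t.
Proof. by move=> t0; rewrite -rho0 ltr_rho. Qed.

Lemma sinh_gt0 t : 0 < t -> 0 < sinh t.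
Proof. by move=> /rho_gt0; rewrite /rho pmulr_lgt0 ?expR_gt0. Qed.

(* Completing the square in [y]: the product is, up to the factor
   [exp(-s) psiT x], a Gaussian density centred at [exp(-s) x]. *)
Lemma mehler_psiT s x y : 0 < s ->
  mehler x s y * psiT y = expR (- s) * psiT x *
    (normal_pdf (expR (- s) * x.1) (Num.sqrt (rho s)) y.1 *
     normal_pdf (expR (- s) * x.2) (Num.sqrt (rho s)) y.2).
Proof.
move=> s0; have r0 := rho_gt0 s0; have sh0 := sinh_gt0 s0.
have pi0 := @pi_gt0 R.
rewrite !normal_pdfE ?sqrtr_eq0 -?ltNge// /normal_peak /normal_fun.
rewrite !sqr_sqrtr ?(ltW r0)//.
(* [P] normalizes each one-dimensional Gaussian; its square, free of roots, is the planar
   constant. *)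
set P := (Num.sqrt (rho s * pi *+ 2))^-1.
have PP : P * P = (2 * pi * rho s)^-1.
  rewrite /P -invfM -expr2 sqr_sqrtr; last by rewrite mulrn_wge0// mulr_ge0 ?ltW.
  by congr _^-1; ring.
rewrite [RHS](_ : _ = expR (- s) * (P * P) *
  (psiT x * (expR (- (y.1 - expR (- s) * x.1) ^+ 2 / (rho s *+ 2)) *
             expR (- (y.2 - expR (- s) * x.2) ^+ 2 / (rho s *+ 2)))));
  last by ring.
rewrite PP /psiT /mehler -[LHS]mulrA -!expRD; congr (_ * expR _).
  by rewrite /rho; have := expR_gt0 (- s) => f0; field; lra.
(* In terms of e = exp(s) the exponents are rational functions, and e > 1 keeps the denominators
   nonzero. *)
rewrite !enorm_sqr /inner /rho /sinh /cosh expRN.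
have : 1 < expR s by rewrite expR_gt1.
move: (expR s) => e e1; field.
nra.
Qed.

Lemma measurable_psiT : measurable_fun setT (@psiT R).
Proof.
rewrite (_ : @psiT R = fun x => expR (- (inner x x / 2))); last first.
  by apply/funext => x; rewrite /psiT enorm_sqr.
apply: measurableT_comp => //; apply: measurableT_comp => //.
by apply: measurable_funM => //; exact: measurable_sqnorm.
Qed.

Lemma measurable_mehler x t : measurable_fun setT (mehler x t).
Proof.
rewrite (_ : mehler x t = fun y => (2 * pi * sinh t)^-1 *
  expR (- ((cosh t * (enorm x ^+ 2 + inner y y) - 2 * inner x y)
           / (2 * sinh t)))); last first.
  by apply/funext => y; rewrite /mehler (enorm_sqr y).
apply: measurable_funM => //; apply: measurableT_comp => //.
apply: measurableT_comp => //; apply: measurable_funM => //.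
apply: measurable_funB; apply: measurable_funM => //.
  by apply: measurable_funD => //; exact: measurable_sqnorm.
apply: measurable_funD; apply: measurable_funM => //;
  by [exact: measurable_fst|exact: measurable_snd].
Qed.

(** After completing the square, Tonelli splits the integral into two normal densities of mass 1,
    leaving only the prefactor. *)
Lemma integral_mehler_psiT s x : 0 < s ->
  \int[lebesgue2 R]_y (mehler x s y * psiT y) = expR (- s) * psiT x.
Proof.
move=> s0; rewrite /Rintegral.
set sg := Num.sqrt (rho s).
have sg0 : sg != 0 by rewrite sqrtr_eq0 -ltNge rho_gt0.
under eq_integral do rewrite mehler_psiT//.
have mpdf m : measurable_fun setT (normal_pdf m sg : R -> R).
  exact: measurable_normal_pdf.
have c0 : 0 <= expR (- s) * psiT x by rewrite mulr_ge0 ?expR_ge0.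
have mf : measurable_fun [set: plane R] (fun y =>
    normal_pdf (expR (- s) * x.1) sg y.1 *
    normal_pdf (expR (- s) * x.2) sg y.2).
  apply: measurable_funM.
    exact: (measurableT_comp (mpdf _) measurable_fst).
  exact: (measurableT_comp (mpdf _) measurable_snd).
under eq_integral do rewrite EFinM.
rewrite ge0_integralZl//; last 2 first.
- exact/measurable_EFinP.
- by move=> y _; rewrite lee_fin mulr_ge0 ?normal_pdf_ge0.
rewrite fubini_tonelli1/=; last 2 first.
- exact/measurable_EFinP.
- by move=> y; rewrite lee_fin mulr_ge0 ?normal_pdf_ge0.
rewrite /fubini_F/=.
under eq_integral => y1 _.
  under eq_integral do rewrite EFinM.
  rewrite ge0_integralZl//; last 3 first.
  - apply/measurable_EFinP; exact: measurable_normal_pdf.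
  - by move=> y2 _; rewrite lee_fin normal_pdf_ge0.
  - by rewrite lee_fin normal_pdf_ge0.
  rewrite integral_normal_pdf// mule1.
  over.
by rewrite integral_normal_pdf// mule1.
Qed.

Lemma forward_solE N x t : forward_sol N x t =
  N * ((2 * pi * sinh t)^-1 * expR (- (cosh t * enorm x ^+ 2 / (2 * sinh t)))).
Proof.
rewrite /forward_sol /Rintegral integral_dirac//; last first.
  by apply/measurable_EFinP; exact: measurable_mehler.
rewrite diracT mul1e.
rewrite [fine _]/=.
rewrite /mehler.
rewrite (enorm_sqr (origin R)) !/(inner _ (origin R)).
rewrite [(origin R).1]/= [(origin R).2]/= !mulr0 !addr0 mulr0 subr0.
by [].
Qed.

(** Before [T] this is the eigenvalue relation with elapsed time T - t; at [T] the exponential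
    factor is 1, so one formula serves both branches. *)
Lemma backward_solE T N x t : t <= T ->
  backward_sol T N x t = N * (expR (t - T) * psiT x).
Proof.
rewrite /backward_sol; case: ltgtP => // [tT _|-> _].
  by rewrite integral_mehler_psiT ?subr_gt0// opprB.
by rewrite subrr expR0 mul1r.
Qed.

(** Both the prefactor and the exponent reduce by coth t + 1 = exp(t) / sinh t = 1 / rho t, while
    the remaining constant N^2 exp(-T) is 1. *)
Lemma forward_backward_density T N x t : 0 < t <= T ->
  N ^+ 2 * expR (- T) = 1 ->
  forward_sol N x t * backward_sol T N x t =
  (2 * pi * rho t)^-1 * expR (- (enorm x ^+ 2 / (2 * rho t))).
Proof.
move=> /andP[t0 tT] NT; rewrite forward_solE backward_solE// expRD.
have sh0 := sinh_gt0 t0; have pi0 := @pi_gt0 R.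
have f0 := expR_gt0 (- t).
set E1 := expR (- (cosh t * _ / _)).
rewrite [LHS](_ : _ = (N ^+ 2 * expR (- T)) *
  ((2 * pi * sinh t)^-1 * expR t * (E1 * psiT x))); last by ring.
rewrite NT mul1r /psiT /E1 -expRD; congr (_ * expR _).
  have -> : expR t = (expR (- t))^-1 by rewrite expRN invrK.
  by rewrite /rho; field; lra.
rewrite /rho /sinh /cosh expRN.
have : 1 < expR t by rewrite expR_gt1.
move: (expR t) => e e1; field.
nra.
Qed.

End Kernel.

(** * Monotonicity of a difference of two exponentials *)

Section ExponentialDifference.
Variable R : realType.
Implicit Types a b s x y : R.

Let h a b s := expR (- (a * s)) - expR (- (b * s)).

Let dh a b s :
  is_derive s 1 (h a b) (b * expR (- (b * s)) - a * expR (- (a * s))).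
Proof. by rewrite /h; apply: is_derive_eq; rewrite /GRing.scale/=; ring. Qed.

Let derivable_h a b s : derivable (h a b) s 1.
Proof. by have [] := dh a b s. Qed.

Let derive1_h a b s :
  derive1 (h a b) s = b * expR (- (b * s)) - a * expR (- (a * s)).
Proof. by rewrite derive1E; have /@derive_val -> := dh a b s. Qed.

Let continuous_h a b : continuous (h a b).
Proof. by move=> s; apply: cvgB; exact: continuous_expRN. Qed.

(** The derivative is exp(-az) (b exp(-(b-a)z) - a). By exp(u) >= 1 + u the bracket is at least (b -
    a)(1 - bz), positive for z < y. *)
Lemma expRB_increasing a b x y : 0 < a -> a < b -> x < y -> b * y <= 1 ->
  expR (- (a * x)) - expR (- (b * x)) < expR (- (a * y)) - expR (- (b * y)).
Proof.
move=> a0 ab xy by1.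
apply: (@gtr0_derive1_lt_cc R (h a b) x y) => //.
- move=> z; rewrite in_itv/= => /andP[_ zy]; rewrite derive1_h.
  have -> : - (b * z) = - (a * z) + - ((b - a) * z) by ring.
  rewrite expRD.
  have := expR_ge1Dx (- ((b - a) * z)).
  move: (expR (- (a * z))) (expR_gt0 (- (a * z))) => A A0.
  move: (expR _) => E E1; have bz : b * z < 1 by nra.
  have -> : b * (A * E) - a * A = A * (b * E - a) by ring.
  by rewrite mulr_gt0//; nra.
- exact: continuous_subspaceT.
- by rewrite in_itv/= lexx ltW.
- by rewrite in_itv/= lexx ltW.
Qed.

(** Factoring out exp(-bz) instead, minus the derivative is exp(-bz) (a exp((b-a)z) - b), whose
    bracket is at least (b - a)(az - 1), positive for z > x. *)
Lemma expRB_decreasing a b x y : 0 < a -> a < b -> 1 <= a * x -> x < y ->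
  expR (- (a * y)) - expR (- (b * y)) < expR (- (a * x)) - expR (- (b * x)).
Proof.
move=> a0 ab ax1 xy.
apply: (@ltr0_derive1_lt_cc R (h a b) x y) => //.
- move=> z; rewrite in_itv/= => /andP[xz _]; rewrite derive1_h.
  have -> : - (a * z) = - (b * z) + (b - a) * z by ring.
  rewrite expRD.
  have := expR_ge1Dx ((b - a) * z).
  move: (expR (- (b * z))) (expR_gt0 (- (b * z))) => B B0.
  move: (expR _) => E E1; have az : 1 < a * z by nra.
  have -> : b * B - a * (B * E) = - (B * (a * E - b)) by ring.
  by rewrite oppr_lt0 mulr_gt0//; nra.
- exact: continuous_subspaceT.
- by rewrite in_itv/= lexx ltW.
- by rewrite in_itv/= lexx ltW.
Qed.

End ExponentialDifference.

(** * Probabilities of annuli under the process *)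

Section AnnulusProbability.
Variables (R : realType) (T N : R) (d : measure_display).
Variables (Omega : measurableType d) (P : probability Omega R).
Variables (Z : R -> Omega -> plane R).
Hypothesis procZ : bernstein_process T N P Z.

(** The constant is N v(0, 0). It is kept symbolic because its value 1 is deduced from this very
    formula. *)
Lemma initial_law (F : set (plane R)) : measurable F ->
  P (Z 0 @^-1` F) = (dirac (origin R) F * (N ^+ 2 * expR (- T))%:E)%E.
Proof.
move=> mF; rewrite (marginal0E procZ)//.
have T0 := ltW (horizon_gt0 procZ).
under eq_integral do rewrite backward_solE//.
rewrite integral_dirac//; last first.
  apply: measurable_funTS; apply/measurable_EFinP.
  apply: measurable_funM => //; apply: measurable_funM => //.
  exact: measurable_psiT.
rewrite sub0r muleCA; congr (_ * _)%E; rewrite -EFinM; congr EFin.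
rewrite /psiT enorm_sqr /inner [(origin R).1]/= [(origin R).2]/=.
by rewrite !mulr0 addr0 mul0r oppr0 expR0; ring.
Qed.

(** Read off from the total mass 1 of the law at time 0. *)
Lemma normalization_sqr : N ^+ 2 * expR (- T) = 1.
Proof.
have := initial_law measurableT.
by rewrite preimage_setT probability_setT diracT mul1e => -[].
Qed.

Lemma annulus_prob0 r1 r2 : 0 <= r1 -> 0 <= r2 ->
  P (Z 0 @^-1` annulus r1 r2) = dirac (origin R) (annulus r1 r2).
Proof.
move=> r10 r20; rewrite initial_law ?normalization_sqr ?mule1//.
exact: measurable_annulus.
Qed.

Lemma annulus_probE t r1 r2 : 0 < t <= T -> 0 <= r1 -> r1 <= r2 ->
  P (Z t @^-1` annulus r1 r2) =
  (expR (- (r1 ^+ 2 / (2 * rho t))) - expR (- (r2 ^+ 2 / (2 * rho t))))%:E.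
Proof.
move=> tT r10 r12; have /andP[t0 _] := tT.
rewrite (marginalE procZ)//; last exact: measurable_annulus (le_trans r10 r12).
under eq_integral do rewrite (forward_backward_density _ _ normalization_sqr)//.
by rewrite gaussian_annulus ?rho_gt0.
Qed.

End AnnulusProbability.

(** * Behaviour in time of the annulus probabilities *)

Theorem proposition2 (R : realType) :
  (* (a) *)
  (forall (R2 : R), 0 < R2 ->
   forall (T N : R) (d : measure_display) (Omega : measurableType d)
     (P : probability Omega R) (Z : R -> Omega -> plane R),
     bernstein_process T N P Z ->
     let p (t : R) : \bar R := P (Z t @^-1` annulus 0 R2) in
     [/\ p 0 = 1%E,
         forall s t : R, 0 <= s -> s < t -> t <= T -> (p t < p s)%E,
         forall t : R, 0 <= t <= T -> (p T <= p t)%E &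
         p T = (1 - expR (- (R2 ^+ 2 / (2 * rho T))))%:E])
  /\
  (* (b) *)
  (forall R1 R2 : R, 0 < R1 -> R1 < R2 -> R2 < 1 ->
   (forall (T N : R) (d : measure_display) (Omega : measurableType d)
      (P : probability Omega R) (Z : R -> Omega -> plane R),
      bernstein_process T N P Z ->
      let p (t : R) : \bar R := P (Z t @^-1` annulus R1 R2) in
      p 0 = 0%E /\ (forall t : R, 0 < t <= T -> (0 < p t)%E))
   /\
   (exists T0 : R, forall T : R, T0 <= T ->
    forall (N : R) (d : measure_display) (Omega : measurableType d)
      (P : probability Omega R) (Z : R -> Omega -> plane R),
      bernstein_process T N P Z ->
      let p (t : R) : \bar R := P (Z t @^-1` annulus R1 R2) in
      exists2 tstar : R, 0 < tstar < T &
        forall s t : R, tstar <= s -> s < t -> t <= T -> (p t < p s)%E))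
  /\
  (* (c) *)
  (forall R1 R2 : R, 1 <= R1 -> R1 < R2 ->
   forall (T N : R) (d : measure_display) (Omega : measurableType d)
     (P : probability Omega R) (Z : R -> Omega -> plane R),
     bernstein_process T N P Z ->
     let p (t : R) : \bar R := P (Z t @^-1` annulus R1 R2) in
     p 0 = 0%E /\
     (forall s t : R, 0 <= s -> s < t -> t <= T -> (p s < p t)%E)).
Proof.
(* Exposes the exponents as linear in 1 / rho t, the variable of the two monotonicity lemmas. *)
have sqh (r t : R) : r ^+ 2 / (2 * rho t) = r ^+ 2 / 2 * (rho t)^-1.
  by rewrite invfM mulrA.
have sq_lt (r1 r2 : R) : 0 <= r1 -> r1 < r2 -> r1 ^+ 2 / 2 < r2 ^+ 2 / 2.
  by move=> r10 r12; rewrite ltr_pM2r// ltr_sqr ?nnegrE//; lra.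
have exp_lt (r1 r2 t : R) : 0 <= r1 -> r1 < r2 -> 0 < t ->
    expR (- (r2 ^+ 2 / (2 * rho t))) < expR (- (r1 ^+ 2 / (2 * rho t))).
  move=> r10 r12 t0; rewrite ltr_expR ltrN2 !sqh ltr_pM2r ?sq_lt//.
  by rewrite invr_gt0 rho_gt0.
have rhoV (s t : R) : 0 < s -> s < t -> (rho t)^-1 < (rho s)^-1.
  move=> s0 st; rewrite ltf_pV2 ?posrE ?rho_gt0 ?ltr_rho//.
  exact: lt_trans st.
split; [|split].
- move=> R2 R20 T N d Omega P Z pZ p.
  have T0 := horizon_gt0 pZ.
  have p0 : p 0 = 1%E.
    rewrite /p (annulus_prob0 pZ) ?(ltW R20)// diracE mem_set//=.
    by rewrite /annulus/= enorm_origin lexx.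
  have pE t : 0 < t <= T -> p t = (1 - expR (- (R2 ^+ 2 / (2 * rho t))))%:E.
    move=> tT; rewrite /p (annulus_probE pZ)// ?(ltW R20)//.
    by rewrite expr0n/= mul0r oppr0 expR0.
  have dec s t : 0 <= s -> s < t -> t <= T -> (p t < p s)%E.
    (* Time 0 is separate: there [rho] vanishes, and with the inverse of 0 being 0 the closed
       formula would give 0 instead of 1. *)
    rewrite le_eqVlt => /predU1P[<- t0 tT|s0 st tT].
      by rewrite p0 pE ?t0// lte_fin ltrBlDr ltrDl expR_gt0.
    rewrite !pE ?s0 ?(lt_trans s0 st) ?(le_trans (ltW st))//.
    rewrite lte_fin ltrD2l ltrN2 ltr_expR ltrN2 !sqh ltr_pM2l ?rhoV//.
    by rewrite divr_gt0 ?exprn_gt0.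
  split => //; last by rewrite pE// T0 lexx.
  move=> t /andP[t0]; rewrite le_eqVlt => /predU1P[->//|tT].
  exact/ltW/dec.
- move=> R1 R2 R10 R12 R21; split.
    move=> T N d Omega P Z pZ p; split.
      rewrite /p (annulus_prob0 pZ) ?(ltW R10) ?(ltW (lt_trans R10 R12))//.
      rewrite diracE memNset//=.
      by rewrite /annulus/= enorm_origin; lra.
    move=> t tT; have /andP[t0 _] := tT.
    by rewrite /p (annulus_probE pZ) ?(ltW R10) ?(ltW R12)// lte_fin subr_gt0
      exp_lt// ltW.
  have R22 : 0 < 1 - R2 ^+ 2 by nra.
  (* The solution of 1 - exp(-2t) = R2^2, that is, the time when rho equals b = R2^2 / 2; R2 < 1
     makes the logarithm meaningful. *)
  pose tstar := - (ln (1 - R2 ^+ 2) / 2).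
  have rho_tstar : rho tstar = R2 ^+ 2 / 2.
    by rewrite rhoE (_ : - (2 * tstar) = ln (1 - R2 ^+ 2)) ?lnK ?posrE//;
      [field|rewrite /tstar; field].
  have tstar0 : 0 < tstar by rewrite -ltr_rho rho0 rho_tstar; nra.
  (* The margin 1 turns the weak bound on [T] into the strict tstar < T. *)
  exists (tstar + 1) => T T1 N d Omega P Z pZ p; exists tstar; first lra.
  move=> s t ss st tT; have s0 : 0 < s by lra.
  have t0 := lt_trans s0 st.
  rewrite /p !(annulus_probE pZ) ?(ltW R10) ?(ltW R12) ?s0 ?t0 ?(le_trans (ltW st))//.
  (* From [tstar] on, b / rho s <= 1, so the difference increases with 1 / rho, which itself
     decreases in time. *)
  rewrite lte_fin !sqh expRB_increasing ?rhoV ?sq_lt ?(ltW R10)//; first by nra.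
  rewrite ler_pdivrMr ?rho_gt0// mul1r -rho_tstar.
  by move: ss; rewrite le_eqVlt => /predU1P[->//|]; rewrite -ltr_rho => /ltW.
- move=> R1 R2 R11 R12 T N d Omega P Z pZ p.
  have p0 : p 0 = 0%E.
    rewrite /p (annulus_prob0 pZ); [|lra|lra].
    by rewrite diracE memNset// /annulus/= enorm_origin; lra.
  have R10 : 0 <= R1 by lra.
  split => // s t; rewrite le_eqVlt => /predU1P[<- t0 tT|s0 st tT].
    by rewrite p0 /p (annulus_probE pZ) ?t0 ?(ltW R12)// lte_fin subr_gt0 exp_lt.
  have t0 := lt_trans s0 st.
  rewrite /p !(annulus_probE pZ) ?(ltW R12) ?s0 ?t0 ?(le_trans (ltW st))//.
  (* Here a = R1^2 / 2 is at least 1/2, hence exceeds rho t: the difference decreases in 1 / rho, so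
     the probability grows with time. *)
  rewrite lte_fin !sqh expRB_decreasing ?rhoV ?sq_lt//; first by nra.
  rewrite ler_pdivlMr ?rho_gt0// mul1r.
  by have := rho_lt_half t; nra.
Qed.
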